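(* There exists a constant $C>0$ such that for every integer $n\ge 2$, any $2$-uniformity network on $n$ elements in which each transposition is a star transposition (i.e. every lazy transposition in the sequence has the form $(1,x,p)$ with $x\in\{2,\dots,n\}$ and $p\in[0,1]$) has at least $1.6\,n-C$ transpositions.
   Context: Write $[n]=\{1,\dots,n\}$, let $S_n$ be the symmetric group on $[n]$, and for distinct $a,b\in[n]$ let $(a,b)\in S_n$ denote the transposition swapping $a$ and $b$. For $p\in[0,1]$, the lazy transposition $T=(a,b,p)$ is the random permutation which equals $(a,b)$ with probability $p$ and equals the identity of $S_n$ otherwise. For $1\le t\le n$, a finite sequence of independent lazy transpositions $T_1,\dots,T_\ell$ is a $t$-uniformity network on $n$ elements if the probability that the composition $T_1\cdots T_\ell$ maps the tuple $(1,\dots,t)$ to $(x_1,\dots,x_t)$ is the same for every tuple $(x_1,\dots,x_t)$ of $t$ distinct elements of $[n]$. Products are applied in the order of the sequence, left to right: $T_1$ is applied first (equivalently, counters placed at positions $1,\dots,t$ are moved by carrying out the lazy transpositions in order). The number of transpositions in the network is $\ell$, counted with repetition. *)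

(* Defs.v *)
From mathcomp Require Import all_boot all_order all_algebra all_fingroup.
From mathcomp Require Import reals.

Set Implicit Arguments.
Unset Strict Implicit.
Unset Printing Implicit Defensive.

Import Order.TTheory GRing.Theory Num.Theory.
Local Open Scope ring_scope.

(** [n] = {1, ..., n} is encoded as 'I_n = {0, ..., n - 1}, so the element
    k of [n] is the ordinal with value k - 1; in particular 1 is ordinal 0. *)

Record lazy_transposition (R : realType) (n : nat) := LazyTransposition {
  lt_fst : 'I_n;
  lt_snd : 'I_n;
  lt_prob : R;
  lt_distinct : lt_fst != lt_snd;
  lt_prob01 : 0 <= lt_prob <= 1
}.

(** Law of the random permutation: the two values are different permutations
    because [lt_fst T != lt_snd T]. *)
Definition lt_law (R : realType) (n : nat) (T : lazy_transposition R n)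
    (s : 'S_n) : R :=
  if s == tperm (lt_fst T) (lt_snd T) then lt_prob T
  else if s == 1%g then 1 - lt_prob T
  else 0.

(** Probability, under the product law (independence), that the composition
    T_1 ... T_l satisfies [E].  Since [(s * t)%g x = t (s x)], the product
    applies T_1 first. *)
Definition pr_composition (R : realType) (n l : nat)
    (T : l.-tuple (lazy_transposition R n)) (E : pred 'S_n) : R :=
  \sum_(w : {ffun 'I_l -> 'S_n} | E (\prod_(i < l) w i)%g)
    \prod_(i < l) lt_law (tnth T i) (w i).

(** [[tuple s (widen_ord htn i) | i < t]] is the image of (1, ..., t). *)
Definition uniformity_network (R : realType) (n t : nat) (htn : (t <= n)%N)
    (l : nat) (T : l.-tuple (lazy_transposition R n)) : Prop :=
  forall x y : t.-tuple 'I_n, uniq x -> uniq y ->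
    pr_composition T (fun s => [tuple s (widen_ord htn i) | i < t] == x) =
    pr_composition T (fun s => [tuple s (widen_ord htn i) | i < t] == y).

Definition is_star (R : realType) (n : nat) (T : lazy_transposition R n) : Prop :=
  nat_of_ord (lt_fst T) = 0%N.

(* Main.v *)
Require Import Defs.
From mathcomp Require Import all_boot all_order all_algebra all_fingroup.
From mathcomp Require Import reals ring lra zify.

Set Implicit Arguments.
Unset Strict Implicit.
Unset Printing Implicit Defensive.

Import Order.TTheory GRing.Theory Num.Theory.
Local Open Scope ring_scope.

(** Follow the joint law [D] of the positions of the two counters; leaves not yet
    visited are empty.  A leaf visited exactly once has its final law right after
    that visit, at which it is swapped empty.  If [x], [x'] are consecutive
    once-used leaves, then counter 1 landing in [x] empties the hub, so some
    previously visited leaf must occur in between to bring counter 2 to [x'].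
    If there is exactly one such visit in between and it is the last visit to its
    leaf [y], then uniformity on the pairs among [x], [y], [x'] forces the
    transposition at [x'] to have probability 1; the hub is then empty, and the
    next gap cannot be of the same kind, since counters could not end up in its
    [y] and its [x'] simultaneously.

    Let [O], [V], [F], [N] count the visits that are first and last, first only,
    last only, neither.  Counting gaps gives [3 O <= 2 F + 5 N + 4].  Also
    [O + V] and [O + F] are at least [n - 2] (the leaf initially holding counter 2
    counts as visited), hence [5 l >= 8 O + 5 V + 3 F - 4 >= 8 (n - 2) - 4]. *)

(** * Counting visits by first and last occurrence *)

Section Occurrences.
Variable X : finType.
Implicit Types (seen : {set X}) (s : seq X).

(** With [seen] the leaves visited before [s], the flags [false true], [false false], [true true],
    [true false] give the counts [O], [V], [F], [N]. *)
Fixpoint occ (old last : bool) seen s : nat :=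
  if s is x :: s' then
    (((x \in seen) == old) && ((x \notin s') == last)
     + occ old last (x |: seen) s')%N
  else 0%N.

Lemma occ_size seen s :
  (occ false true seen s + occ false false seen s
   + occ true true seen s + occ true false seen s)%N = size s.
Proof.
elim: s seen => [//|x s IHs] seen /=; rewrite -(IHs (x |: seen)).
by case: (x \in seen); case: (x \in s) => /=; lia.
Qed.

Lemma occ_last seen s :
  (occ false true seen s + occ true true seen s)%N = #|s|.
Proof.
elim: s seen => [|x s IHs] seen; first by rewrite card0.
have -> : #|x :: s| = ((x \notin s) + #|s|)%N by rewrite -cardU1; apply: eq_card.
rewrite -(IHs (x |: seen)) /=.
by case: (x \in seen); case: (x \in s) => /=; lia.
Qed.

Lemma occ_new seen s :
  (#|[set x in s] :\: seen| <= occ false true seen s + occ false false seen s)%N.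
Proof.
elim: s seen => [|x s IHs] seen; first by rewrite set_nil set0D cards0.
have /= := IHs (x |: seen).
have -> : [set y in x :: s] :\: seen
    = (if x \in seen then set0 else [set x]) :|: ([set y in s] :\: (x |: seen)).
  apply/setP => y; rewrite !inE.
  by case: ifPn => xs; rewrite !inE; case: eqVneq => [->|] //=;
    rewrite ?xs ?(negPf xs) ?orbT ?andbF ?andbT ?orbF.
have [+ _] := leq_card_setU (if x \in seen then set0 else [set x]) ([set y in s] :\: (x |: seen)).
by case: (x \in seen); rewrite ?cards0 ?cards1; case: (x \in s) => /=; lia.
Qed.

End Occurrences.

(** * Evolution of the joint law of two counters on a star *)

Section StarWalk.
Variables (R : realFieldType) (X : finType) (h : X).
Implicit Types (T : X * R) (D : X -> X -> R) (s : seq (X * R)) (seen : {set X}).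

Definition star_step D T u v : R :=
  T.2 * D (tperm h T.1 u) (tperm h T.1 v) + (1 - T.2) * D u v.

Definition evolve D s : X -> X -> R := foldl star_step D s.

Definition marginal D u : R := \sum_v D u v.

Definition star_leg T := (T.1 != h) && (0 <= T.2 <= 1).

Lemma marginal_step D T u :
  marginal (star_step D T) u
  = T.2 * marginal D (tperm h T.1 u) + (1 - T.2) * marginal D u.
Proof.
rewrite /marginal /star_step big_split /= -!mulr_sumr; congr (_ * _ + _).
by rewrite [RHS](reindex_inj (@perm_inj _ (tperm h T.1))).
Qed.

(** Later swaps touch neither [u] nor [v], so uniformity at the end becomes an equation on the law
    right after a last visit. *)
Lemma evolve_fixed D s u v :
  u != h -> v != h -> u \notin unzip1 s -> v \notin unzip1 s ->
  evolve D s u v = D u v.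
Proof.
move=> uh vh; elim: s D => [//|T s IHs] D /=; rewrite !inE !negb_or.
move=> /andP[uT us] /andP[vT vs]; rewrite [LHS]IHs // /star_step !tpermD 1?eq_sym //.
by ring.
Qed.

Lemma marginal_fixed D s u :
  u != h -> u \notin unzip1 s -> marginal (evolve D s) u = marginal D u.
Proof.
move=> uh; elim: s D => [//|T s IHs] D /=; rewrite inE negb_or.
move=> /andP[uT us]; rewrite [LHS]IHs // marginal_step tpermD 1?eq_sym //.
by ring.
Qed.

Lemma evolve_diag D s : (forall u, D u u = 0) -> forall u, evolve D s u u = 0.
Proof.
elim: s D => [//|T s IHs] D D0; apply: IHs => u.
by rewrite /star_step !D0 !mulr0 addr0.
Qed.

Lemma evolve_mass D s :
  \sum_u marginal (evolve D s) u = \sum_u marginal D u.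
Proof.
elim: s D => [//|T s IHs] D; rewrite [LHS]IHs.
under eq_bigr do rewrite marginal_step.
rewrite big_split /= -!mulr_sumr.
rewrite [X in _ + _ * X](reindex_perm (tperm h T.1)) [RHS](reindex_perm (tperm h T.1)) /=.
by rewrite -mulrDl addrC subrK mul1r.
Qed.

(** * Invariants of the gap after a once-used leaf *)

(* State of the gap opened by the latest once-used leaf [x]: [Closed b] if only
   first visits to leaves have occurred since, [Half b] if moreover there was a
   single revisit, and it was the last visit to its leaf [y].  The flag [b] says
   that the preceding gap ended in state [Half]; by [single_of_half] the hub was
   then emptied at [x], which is recorded as [rho = 0]. *)
Inductive gap_state := Idle | Closed of bool | Half of bool.

(* How much [3 O - 2 F - 5 N] can have accumulated when in a given state. *)
Definition budget st : nat :=
  match st with Idle => 0 | Closed b => 3 + b | Half b => 1 + b end.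

Variables (pi mu : R).

(** Here [pi] and [mu] stand for the final pair and single probabilities. In [Closed], [rho] is the
    ratio of the hub's law to that of [x]. In [Half], [rho], [d] and [Y] are this ratio, [D x y] and
    the marginal at [y] just before the revisit of [y], which has probability [q]; [beta] collects
    the factors [1 - p] of later first visits. *)
Definition gap_inv st (w : seq X) D : Prop :=
  match st with
  | Idle => True
  | Closed b => exists x rho,
      [/\ x != h /\ x \notin w, D x h = 0 /\ D h x = 0,
          forall y, y != h -> y != x ->
            D h y = rho * D x y /\ D y h = rho * D y x,
          marginal D h = rho * mu & b -> rho = 0]
  | Half b => exists x y beta q rho d Y,
      [/\ [/\ x != h, y != h, x \notin w & y \notin w],
          0 <= beta <= 1,
          (1 - q) * d = pi /\ (1 - q) * Y + q * (rho * mu) = mu,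
          [/\ D x h = beta * (q * d), D y h = beta * (rho * d) &
              marginal D h = beta * (q * Y + (1 - q) * (rho * mu))]
          & b -> rho = 0]
  end.

Definition vacant seen D := forall u, u \notin seen -> forall v, D u v = 0 /\ D v u = 0.

Lemma vacant_marginal seen D u : vacant seen D -> u \notin seen -> marginal D u = 0.
Proof. by move=> vac us; apply: big1 => v _; have [] := vac u us v. Qed.

Lemma vacant_step seen D T : h \in seen -> vacant seen D ->
  vacant (T.1 |: seen) (star_step D T).
Proof.
move=> hs vac u; rewrite !inE negb_or => /andP[uT us] v.
have uh : u != h by apply: contraNneq us => ->.
rewrite /star_step tpermD 1?eq_sym //.
have [-> ->] := vac u us v.
by have [-> ->] := vac u us (tperm h T.1 v); rewrite !mulr0 addr0.
Qed.

(** A swap of probability [p] with an empty leaf moves a share [p] of the hub's law there and leaves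
    [1 - p], whence [rho = (1 - p) / p]. *)
Lemma closed_after_single w seen D T (b : bool) :
  h \in seen -> T.1 != h -> T.1 \notin seen -> T.1 \notin w -> vacant seen D ->
  T.2 != 0 -> marginal (star_step D T) T.1 = mu -> (b -> T.2 = 1) ->
  gap_inv (Closed b) w (star_step D T).
Proof.
case: T => x p /= hs xh xs xw vac p0; rewrite marginal_step /= tpermR.
rewrite (vacant_marginal vac xs) mulr0 addr0 => pm bp.
have V := vac _ xs.
exists x, ((1 - p) / p); split=> //.
- by rewrite /star_step /= tpermL tpermR; have [-> ->] := V h; rewrite !mulr0 addr0.
- move=> y yh yx; rewrite /star_step /= tpermL tpermR tpermD 1?eq_sym //.
  by have [-> ->] := V y; split; field.
- rewrite marginal_step /= tpermL (vacant_marginal vac xs) -pm; by field.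
- by move=> /bp ->; rewrite subrr mul0r.
Qed.

(** An empty leaf takes its share from the hub alone, so [rho] is multiplied by [1 - p]. *)
Lemma closed_virgin w seen D T (b : bool) :
  h \in seen -> T.1 != h -> T.1 \notin seen -> T.1 \in w -> vacant seen D ->
  gap_inv (Closed b) (T.1 :: w) D -> gap_inv (Closed b) w (star_step D T).
Proof.
case: T => u p /= hs uh us uw vac [x [rho [[xh]]]]; rewrite inE negb_or.
move=> /andP[xu xw] [Dxh Dhx] Dy Dm br; have V := vac _ us.
exists x, ((1 - p) * rho); split=> //.
- rewrite /star_step /= tpermL tpermD 1?eq_sym // Dxh Dhx.
  by have [-> ->] := V x; rewrite !mulr0 addr0.
- move=> y yh yx; rewrite /star_step /= tpermL [tperm _ _ x]tpermD 1?eq_sym //.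
  have [->|yu] := eqVneq y u.
    rewrite tpermR Dxh Dhx; have [-> ->] := V h; have [-> ->] := V x.
    by split; ring.
  rewrite tpermD 1?eq_sym //; have [-> ->] := Dy y yh yx; have [-> ->] := V y.
  by split; ring.
- rewrite marginal_step /= tpermL (vacant_marginal vac us) Dm; by ring.
- by move=> /br ->; rewrite mulr0.
Qed.

Lemma half_virgin w seen D T (b : bool) :
  T.1 \notin seen -> star_leg T -> T.1 \in w -> vacant seen D ->
  gap_inv (Half b) (T.1 :: w) D -> gap_inv (Half b) w (star_step D T).
Proof.
case: T => u p /= us /andP[/= uh /andP[p0 p1]] uw vac.
move=> [x [y [beta [q [rho [d [Y [[xh yh xw yw] /andP[b0 b1] eqs [Dx Dy Dm] br]]]]]]]].
move: xw yw; rewrite !inE !negb_or => /andP[xu xw] /andP[yu yw].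
have V := vac _ us.
exists x, y, ((1 - p) * beta), q, rho, d, Y; split=> //.
- by rewrite mulr_ge0 ?subr_ge0 //=; nra.
- rewrite marginal_step /star_step /= tpermL !tpermD 1?eq_sym // Dx Dy Dm.
  rewrite (vacant_marginal vac us).
  by have [_ ->] := V x; have [_ ->] := V y; split; ring.
Qed.

Lemma half_of_closed w D T (b : bool) :
  T.1 != h -> T.1 \notin w -> pi != 0 ->
  (forall u v, u != h -> v != h -> u != v -> u \notin w -> v \notin w ->
     star_step D T u v = pi) ->
  marginal (star_step D T) T.1 = mu ->
  gap_inv (Closed b) (T.1 :: w) D -> gap_inv (Half b) w (star_step D T).
Proof.
case: T => y q /= yh yw pi0 fin; rewrite marginal_step /= tpermR => Mu.
move=> [x [rho [[xh]]]]; rewrite inE negb_or => /andP[xy xw] [Dxh Dhx] Dy Dm br.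
have yx : y != x by rewrite eq_sym.
have [Dhy Dyh] := Dy y yh yx.
have e2 := fin x y xh yh xy xw yw; have e1 := fin y x yh xh yx yw xw.
rewrite /star_step /= tpermR tpermD 1?eq_sym // Dxh Dhx !mulr0 !add0r in e1 e2.
have q1 : 1 - q != 0 by apply: contra_neq pi0 => q1; rewrite -e1 q1 mul0r.
have ed : D y x = D x y by apply: (mulfI q1); rewrite e1 e2.
exists x, y, 1, q, rho, (D x y), (marginal D y); split=> //.
- by rewrite ler01 lexx.
- by split=> //; rewrite -[RHS]Mu Dm; ring.
- rewrite marginal_step /star_step /= tpermL tpermR tpermD 1?eq_sym //.
  by rewrite Dxh Dhy Dyh ed Dm; split; ring.
Qed.

(* Equating the final probabilities of [(x, y)], [(x, x')] and [(y, x')] gives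
   [rho = q]; the two marginal equations then force [q ^+ 2 = (1 - q) ^+ 2]. *)
Lemma single_of_half w seen D T (b : bool) :
  star_leg T -> T.1 \notin seen -> T.1 \notin w -> vacant seen D ->
  pi != 0 -> mu != 0 ->
  (forall u v, u != h -> v != h -> u != v -> u \notin w -> v \notin w ->
     star_step D T u v = pi) ->
  marginal (star_step D T) T.1 = mu ->
  gap_inv (Half b) (T.1 :: w) D -> b = false /\ T.2 = 1.
Proof.
case: T => z p /= /andP[/= zh /andP[p0 p1]] zs zw vac pi0 mu0 fin.
rewrite marginal_step /= tpermR (vacant_marginal vac zs).
move=> Mz [x [y [beta [q [rho [d [Y [[xh yh xw yw] /andP[b0 b1] [ed eY] [Dx Dy Dm] br]]]]]]]].
move: xw yw; rewrite !inE !negb_or => /andP[xz xw] /andP[yz yw].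
have V := vac _ zs.
have := fin x z xh zh xz xw zw; have := fin y z yh zh yz yw zw.
rewrite /star_step /= tpermR !tpermD 1?eq_sym // Dx Dy.
have [_ ->] := V x; have [_ ->] := V y; rewrite !mulr0 !addr0 => e1 e2.
rewrite Dm mulr0 addr0 in Mz.
have d0 : d != 0 by apply: contra_neq pi0 => d0; rewrite -ed d0 mulr0.
pose s := p * beta.
have sq : s * q = 1 - q by apply: (mulIf d0); rewrite ed -e2 /s; ring.
have sr : s * rho = 1 - q by apply: (mulIf d0); rewrite ed -e1 /s; ring.
have s0 : s != 0.
  by apply: contra_neq pi0 => s0; rewrite -e1 mulrA -/s s0 mul0r.
have rq : rho = q by apply: (mulfI s0); rewrite sq sr.
have q2 : q = 1 / 2.
  have E : (1 - 2 * q) * mu = 0.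
    have E1 : s * q * Y + s * q * (1 - q) * mu = mu by rewrite -[RHS]Mz rq /s; ring.
    rewrite sq in E1; rewrite rq in eY.
    have -> : (1 - 2 * q) * mu = ((1 - q) * Y + (1 - q) * (1 - q) * mu)
        - ((1 - q) * Y + q * (q * mu)) by ring.
    by rewrite E1 eY subrr.
  by move/eqP: E; rewrite mulf_eq0 (negPf mu0) orbF => /eqP; lra.
split.
  by apply/negP => /br; rewrite rq q2; lra.
(* Now [p * beta = 1] with both factors in [0, 1], which leaves only [p = 1]. *)
by move: sq; rewrite q2 /s => sq; nra.
Qed.

(** Potential argument: an [O] visit raises the budget by 3, an [F] visit lowers it by at most 2, an
    [N] visit resets it, a [V] visit keeps it, and it never exceeds 4. *)
Lemma gap_count s D seen st :
  all star_leg s -> h \in seen -> pi != 0 -> mu != 0 -> vacant seen D ->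
  (forall u v, u != v -> evolve D s u v = pi) ->
  (forall u, marginal (evolve D s) u = mu) ->
  gap_inv st (unzip1 s) D ->
  (3 * occ false true seen (unzip1 s) + budget st
   <= 2 * occ true true seen (unzip1 s) + 5 * occ true false seen (unzip1 s) + 4)%N.
Proof.
move=> ok hs pi0 mu0; elim: s ok D seen st hs => [|T s IHs] /=.
  by move=> _ D seen [|[]|[]].
move=> /andP[okT ok] D seen st hs vac fin mar.
have Th : T.1 != h by case/andP: okT.
have hs' : h \in T.1 |: seen by rewrite inE hs orbT.
have vac' := @vacant_step seen D T hs vac.
have IH st' := IHs ok _ _ st' hs' vac' fin mar.
set w := unzip1 s in IH *.
have fin' u v : u != h -> v != h -> u != v -> u \notin w -> v \notin w ->
    star_step D T u v = pi.
  by move=> uh vh uv uw vw; rewrite -(fin u v uv) [RHS]evolve_fixed.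
have mar' u : u != h -> u \notin w -> marginal (star_step D T) u = mu.
  by move=> uh uw; rewrite -(mar u) [RHS]marginal_fixed.
have IH0 := IH Idle I; rewrite /= in IH0.
have [old|new] := boolP (T.1 \in seen); have [Tw|Tw] /= := boolP (T.1 \in w).
- by move=> _; case: st => [|[]|[]] /=; lia.
- case: st => [_|b inv|b _].
  + by move=> /=; lia.
  + have /IH := half_of_closed Th Tw pi0 fin' (mar' _ Th Tw) inv.
    by case: b {inv} => /=; lia.
  + by case: b => /=; lia.
- case: st => [_|b inv|b inv].
  + by move=> /=; lia.
  + by have /IH := closed_virgin hs Th new Tw vac inv; lia.
  + by have /IH := half_virgin new okT Tw vac inv; lia.
have mT := mar' _ Th Tw.
have p0 : T.2 != 0.
  apply: contra_neq mu0 => p0; rewrite -mT marginal_step p0 mul0r add0r subr0 mul1r.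
  exact: vacant_marginal vac new.
case: st => [_|b [x [rho [[xh]]]]|b inv].
- have /IH := @closed_after_single w seen D T false hs Th new Tw vac p0 mT (fun e => match e with end).
  by move=> /=; lia.
- rewrite inE negb_or => /andP[xT xw] [Dxh _] _ _ _.
  (* Directly after [Closed], the pair [(x, T.1)] would get final probability 0. *)
  case/eqP: pi0; rewrite -(fin' x T.1) // /star_step tpermR tpermD 1?eq_sym // Dxh.
  by have [_ ->] := vac _ new x; rewrite !mulr0 addr0.
(* The flag must be false, so the budget rises from 1 to 4, that of [Closed true]. *)
have [b0 p1] := single_of_half okT new Tw vac pi0 mu0 fin' mT inv.
have /IH := @closed_after_single w seen D T true hs Th new Tw vac p0 mT (fun _ => p1).
by rewrite b0 /=; lia.
Qed.

End StarWalk.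

(** * From random products to the evolved law *)

Lemma sum_ffun_ordS (R : realType) (G : finType) l (F : {ffun 'I_l.+1 -> G} -> R) :
  \sum_w F w
  = \sum_g \sum_(w : {ffun 'I_l -> G}) F [ffun i => oapp w g (unlift ord0 i)].
Proof.
rewrite pair_big /=.
rewrite (reindex (fun gw : G * {ffun 'I_l -> G} =>
  [ffun i => oapp gw.2 gw.1 (unlift ord0 i)])) //=.
exists (fun w => (w ord0, [ffun i => w (lift ord0 i)])) => [[g w] _|w _] /=.
  congr (_, _); first by rewrite ffunE unlift_none.
  by apply/ffunP => i; rewrite !ffunE liftK.
by apply/ffunP => i; rewrite ffunE; case: unliftP => [k|] -> /=; rewrite ?ffunE.
Qed.

Lemma sum_lt_law (R : realType) n (T : lazy_transposition R n) (F : 'S_n -> R) :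
  \sum_s lt_law T s * F s
  = lt_prob T * F (tperm (lt_fst T) (lt_snd T)) + (1 - lt_prob T) * F 1%g.
Proof.
set t := tperm _ _.
have t1 : 1%g != t.
  apply: contraNneq (lt_distinct T) => t1.
  by rewrite -[lt_snd T](tpermL (lt_fst T)) -/t -t1 perm1.
rewrite (bigD1 t) //= (bigD1 1%g) //= big1 => [|s /andP[st s1]].
  by rewrite /lt_law !eqxx (negPf t1) addr0.
by rewrite /lt_law (negPf st) (negPf s1) mul0r.
Qed.

Definition legs (R : realType) n l (T : l.-tuple (lazy_transposition R n)) :=
  [seq (lt_snd t, lt_prob t) | t <- T].

(** Induction splits off the first transposition, which changes [D]; hence [D] is arbitrary. *)
Lemma evolve_composition (R : realType) n l (T : l.-tuple (lazy_transposition R n))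
    (h : 'I_n) (D : 'I_n -> 'I_n -> R) x y :
  (forall i, lt_fst (tnth T i) = h) ->
  evolve h D (legs T) x y
  = \sum_(w : {ffun 'I_l -> 'S_n}) \prod_(i < l) lt_law (tnth T i) (w i)
      * (let s := (\prod_(i < l) w i)^-1%g in D (s x) (s y)).
Proof.
elim: l T D => [|l IHl] T D star.
  rewrite tuple0 /= (bigD1 [ffun => 1%g]) //= [X in _ + X]big1 => [|w].
    by rewrite !big_ord0 invg1 !perm1 mul1r addr0.
  by case/eqP; apply/ffunP => [[]].
case/tupleP: T star => t T star.
have fst_t : lt_fst t = h := star ord0.
have star' i : lt_fst (tnth T i) = h by have := star (lift ord0 i); rewrite tnthS.
rewrite /= [LHS]IHl // sum_ffun_ordS.
under [RHS]eq_bigr => g _.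
  under eq_bigr => w _.
    rewrite !big_ord_recl !ffunE unlift_none /=.
    under eq_bigr do rewrite ffunE liftK tnthS /=.
    under [X in (g * X)%g]eq_bigr do rewrite ffunE liftK /=.
    rewrite tnth0 -mulrA; over.
  rewrite -mulr_sumr; over.
rewrite sum_lt_law fst_t !mulr_sumr -big_split /=; apply: eq_bigr => w _.
rewrite /star_step mul1g invMg tpermV !permM /=; ring.
Qed.

Lemma pr_composition_pair (R : realType) n (hn : (2 <= n)%N) l
    (T : l.-tuple (lazy_transposition R n)) (h j : 'I_n) x y :
  (forall i, lt_fst (tnth T i) = h) -> h = 0%N :> nat -> j = 1%N :> nat ->
  pr_composition T (fun s => [tuple s (widen_ord hn i) | i < 2] == [tuple x; y])
  = evolve h (fun u v => ((u == h) && (v == j))%:R) (legs T) x y.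
Proof.
move=> star h0 j1; rewrite evolve_composition // /pr_composition big_mkcond /=.
apply: eq_bigr => w _; set s := (\prod_(i < l) w i)%g.
have -> : ([tuple s (widen_ord hn i) | i < 2] == [tuple x; y])
    = ((s^-1 x == h) && (s^-1 y == j))%g.
  rewrite !(canF_eq (permKV s)).
  have -> : [tuple s (widen_ord hn i) | i < 2] = [tuple s h; s j].
    apply/eq_from_tnth => i; rewrite tnth_mktuple.
    by case: i => [[|[|//]] i2]; rewrite /tnth /=; congr (s _); apply: val_inj.
  by rewrite -val_eqE /= !eqseq_cons andbT [x == _]eq_sym [y == _]eq_sym.
by case: (_ && _); rewrite ?mulr1 ?mulr0.
Qed.

(** * The lower bound *)

Theorem theorem5 (R : realType) :
  exists C : R, 0 < C /\
    forall (n : nat) (hn : (2 <= n)%N) (l : nat)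
           (T : l.-tuple (lazy_transposition R n)),
      uniformity_network hn T ->
      (forall i : 'I_l, is_star (tnth T i)) ->
      8 / 5 * n%:R - C <= l%:R.
Proof.
(* The constant comes from [8 n <= 5 l + 20]. *)
exists 4; split=> // n hn l T unif star.
pose h : 'I_n := Ordinal (ltnW hn); pose j : 'I_n := Ordinal hn.
have starh i : lt_fst (tnth T i) = h by apply: val_inj; exact: star.
pose D0 (u v : 'I_n) : R := ((u == h) && (v == j))%:R.
pose DL := evolve h D0 (legs T); pose pi := DL h j.
have hj : h != j by [].
have DLpi u v : u != v -> DL u v = pi.
  move=> uv; rewrite /pi /DL -!(pr_composition_pair hn) //.
  by apply: unif; rewrite //= inE uv.
have DLd u : DL u u = 0.
  apply: evolve_diag => {}u; rewrite /D0.
  by case: eqVneq => //= ->; rewrite (negPf hj).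
have card_ne u : #|[pred v : 'I_n | u != v]| = n.-1.
  rewrite -[n in RHS]card_ord -(cardC1 u); apply: eq_card => v.
  by rewrite !inE eq_sym.
have margL u : marginal DL u = n.-1%:R * pi.
  rewrite /marginal (bigID (fun v => u != v)) /= (eq_bigr (fun=> pi)) => [|v /DLpi //].
  rewrite [X in _ + X]big1 => [|v]; last by rewrite negbK => /eqP <-.
  by rewrite addr0 sumr_const card_ne mulr_natl.
have n1 : n.-1%:R != 0 :> R by rewrite pnatr_eq0 -lt0n -ltnS prednK // ltnW.
have mass : \sum_u marginal DL u = 1.
  rewrite evolve_mass (bigD1 h) //= [X in _ + X]big1 => [|u uh]; last first.
    by apply: big1 => v _; rewrite /D0 (negPf uh).
  rewrite addr0 /marginal (bigD1 j) //= big1 => [|v vj].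
    by rewrite /D0 !eqxx addr0.
  by rewrite /D0 (negPf vj) andbF.
have pi0 : pi != 0.
  apply/eqP => pi0; move: mass; rewrite big1 => [/esym/eqP|u _].
    by rewrite oner_eq0.
  by rewrite margL pi0 mulr0.
have mu0 : n.-1%:R * pi != 0 by rewrite mulf_neq0.
have ok : all (star_leg h) (legs T).
  rewrite all_map; apply/all_tnthP => i; rewrite /star_leg /= lt_prob01 andbT.
  by rewrite eq_sym -(starh i) lt_distinct.
pose w := unzip1 (legs T).
pose seen : {set 'I_n} := [set h; j].
have vac : vacant seen D0.
  move=> u; rewrite !inE negb_or => /andP[uh uj] v.
  by rewrite /D0 (negPf uh) (negPf uj) andbF.
have gaps := @gap_count R _ h pi _ (legs T) D0 seen Idle ok (set21 _ _) pi0 mu0 vac DLpi margL I.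
(* An unvisited leaf outside [seen] would stay empty, but its final marginal is nonzero. *)
have used u : u \notin seen -> u \in w.
  move=> us; apply: contraNT pi0 => uw.
  have uh : u != h by apply: contraNneq us => ->; exact: set21.
  have := margL u; rewrite marginal_fixed // (vacant_marginal vac us).
  by move/esym/eqP; rewrite mulf_eq0 (negPf n1).
have cseen : #|~: seen| = (n - 2)%N by rewrite cardsCs setCK cards2 hj card_ord.
have c1 : (n - 2 <= #|[set x in w] :\: seen|)%N.
  rewrite -cseen; apply/subset_leq_card/subsetP => u; rewrite !inE => us.
  by rewrite us used // !inE.
have c2 : (n - 2 <= #|w|)%N.
  rewrite -cseen; apply/subset_leq_card/subsetP => u; rewrite inE; exact: used.
have size_w : size w = l by rewrite !size_map size_tuple.
have news := leq_trans c1 (occ_new seen w); have := occ_size seen w.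
rewrite -(occ_last seen) in c2; rewrite size_w => sizes.
(* [5 l = 5 (O + V) + 3 (O + F) + (2 F + 5 N - 3 O)], where the last bracket is at least [-4]. *)
have : (8 * n <= 5 * l + 20)%N.
  move: gaps news c2 sizes; rewrite -/w addn0.
  move: (occ false true _ _) (occ false false _ _) (occ true true _ _) (occ true false _ _).
  by clear; lia.
by rewrite -(ler_nat R) natrD !natrM; lra.
Qed.
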